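(* Let $J$ denote one of the two intervals $(0,1]$ or $[1,\infty)$, and let $f$ be an automorphism of $J$ (a bijection of $J$ onto itself) with inverse function $\Psi$. If $f$ is a Weierstrass function on $J$, then $$x+y-1 \leq f(\Psi(x)\Psi(y)) \leq xy \quad \text{for all } x,y\in J;$$ and, inductively, for every integer $n\geq 2$ and all $x_1,\dots,x_n\in J$, $$\sum_{i=1}^{n} x_i-(n-1) \leq f\left(\prod_{i=1}^{n}\Psi(x_i)\right)\leq \prod_{i=1}^{n}x_i .$$
   Context: Let $J$ be either $(0,1]$ or $[1,\infty)$. A positive function $f$ on $J$ with $f(1)=1$ is a Weierstrass function on $J$ if $f(x)+f(y)-1\leq f(xy)\leq f(x)f(y)$ for all $x,y\in J$. *)

(* Defs.v *)
From mathcomp Require Import all_boot all_order all_algebra.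
From mathcomp Require Import boolp classical_sets functions set_interval reals.

Set Implicit Arguments.
Unset Strict Implicit.
Unset Printing Implicit Defensive.

Import Order.TTheory GRing.Theory Num.Theory.

Local Open Scope classical_set_scope.
Local Open Scope ring_scope.

(* Functions on J are total functions R -> R; only their values on J matter. *)

Definition weierstrass_interval (R : realType) (J : set R) : Prop :=
  J = `]0, 1]%classic \/ J = `[1, +oo[%classic.

Definition weierstrass_function (R : realType) (J : set R) (f : R -> R) : Prop :=
  [/\ forall x, J x -> 0 < f x,
      f 1 = 1 &
      forall x y, J x -> J y ->
        f x + f y - 1 <= f (x * y) /\ f (x * y) <= f x * f y].

Definition inverse_on (R : realType) (J : set R) (f Psi : R -> R) : Prop :=
  [/\ forall x, J x -> J (Psi x),
      forall x, J x -> Psi (f x) = x &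
      forall x, J x -> f (Psi x) = x].

(* Main.v *)
Require Import Defs.
From mathcomp Require Import all_boot all_order all_algebra.
From mathcomp Require Import boolp classical_sets functions set_interval reals.
From mathcomp Require Import lra.

(** Both inequalities are the Weierstrass inequalities for [f] read in the
    coordinates [u = Psi x]: since [f (Psi x) = x], the two-variable claim is the
    defining inequality at [Psi x] and [Psi y]. For [n] factors, the defining
    inequality is iterated ([weierstrass_prod]): [J] is closed under products, so
    one more factor [u] can be split off a partial product [P]. The lower bound
    gains [f u - 1], and the upper bound is multiplied by [f u], which is
    positive. The iteration starts from the empty product, where [f 1 = 1] makes
    both bounds equalities. *)

Set Implicit Arguments.
Unset Strict Implicit.
Unset Printing Implicit Defensive.

Import Order.TTheory GRing.Theory Num.Theory.

Local Open Scope classical_set_scope.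
Local Open Scope ring_scope.

Lemma weierstrass_interval1 (R : realType) (J : set R) :
  weierstrass_interval J -> J 1.
Proof. by case=> ->; rewrite /= in_itv /= ?ltr01 ?lexx. Qed.

Lemma weierstrass_intervalM (R : realType) (J : set R) (x y : R) :
  weierstrass_interval J -> J x -> J y -> J (x * y).
Proof.
case=> ->; rewrite /= !in_itv /= ?andbT.
  move=> /andP[x0 x1] /andP[y0 y1].
  by rewrite mulr_gt0 //= mulr_ile1 // ltW.
exact: mulr_ege1.
Qed.

(** The induction has to carry the membership of the product in [J], because the
    defining inequality is only available on [J]. *)
Lemma weierstrass_prod (R : realType) (J : set R) (f : R -> R)
    (n : nat) (u : 'I_n -> R) :
  weierstrass_interval J -> weierstrass_function J f -> (forall i, J (u i)) ->
  [/\ J (\prod_(i < n) u i),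
      \sum_(i < n) f (u i) - (n%:R - 1) <= f (\prod_(i < n) u i) &
      f (\prod_(i < n) u i) <= \prod_(i < n) f (u i)].
Proof.
move=> hJ [f_gt0 f1 fM]; elim: n u => [|n IHn] u Ju.
  rewrite !big_ord0 f1; split; [exact: weierstrass_interval1 | lra | by []].
rewrite !big_ord_recr /= -natr1.
have [JP lbP ubP] := IHn (fun i => u (widen_ord (leqnSn n) i)) (fun=> Ju _).
have Jl := Ju ord_max; have [lb ub] := fM _ _ JP Jl.
split; first exact: weierstrass_intervalM.
  by apply: le_trans lb; lra.
by apply: (le_trans ub); rewrite ler_pM2r // f_gt0.
Qed.

Theorem theorem1 (R : realType) (J : set R) (f Psi : R -> R)
    (hJ : weierstrass_interval J)
    (hf : set_bij J J f)
    (hPsi : inverse_on J f Psi)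
    (hW : weierstrass_function J f) :
  (forall x y : R, J x -> J y ->
     x + y - 1 <= f (Psi x * Psi y) /\ f (Psi x * Psi y) <= x * y) /\
  (forall (n : nat) (x : 'I_n -> R), (2 <= n)%N -> (forall i, J (x i)) ->
     \sum_(i < n) x i - (n%:R - 1) <= f (\prod_(i < n) Psi (x i)) /\
     f (\prod_(i < n) Psi (x i)) <= \prod_(i < n) x i).
Proof.
case: hPsi => JPsi _ PsiK; split=> [x y Jx Jy | n x _ Jx].
  case: hW => _ _ /(_ _ _ (JPsi _ Jx) (JPsi _ Jy)).
  by rewrite !PsiK.
have [_ lb ub] := weierstrass_prod hJ hW (fun i => JPsi _ (Jx i)).
have fPsi i : f (Psi (x i)) = x i by exact: PsiK.
move: lb ub; rewrite (eq_bigr _ (fun i _ => fPsi i)).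
by rewrite [in X in _ -> X -> _](eq_bigr _ (fun i _ => fPsi i)).
Qed.
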